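(* Let $G$ be a compact Lie group, let $A\in\Psi^0(G)$ be a classical pseudo-differential operator of order zero with matrix-valued global symbol $\sigma_{\mathrm{glob}}$, and let $\xi=(\xi_{ij})_{i,j=1}^{d_\xi}:G\to U(d_\xi)$ be a (matrix) representative of a class $[\xi]\in\widehat G$. Then $$\sum_{i,j=1}^{d_\xi}(A\xi_{ij},\xi_{ij})=\int_G\mathrm{Tr}(\sigma_{\mathrm{glob}}(x,\xi))\,dx.$$
   Context: $dx$ is the normalised Haar measure on $G$ and $(f,h)=\int_G f(x)\overline{h(x)}\,dx$ is the inner product of $L^2(G)$. $\widehat G$ is the set of equivalence classes of continuous irreducible unitary representations of $G$; a representative $\xi$ of dimension $d_\xi$ is written as a unitary matrix-valued function $\xi(x)=(\xi_{ij}(x))_{i,j=1}^{d_\xi}$. $\Psi^0(G)$ is the Kohn–Nirenberg (Hörmander $(1,0)$) class of pseudo-differential operators of order $0$ on the manifold $G$; such an operator maps $C^\infty(G)$ continuously and linearly into $C^\infty(G)$. The matrix-valued global symbol of $A$ is $\sigma_{\mathrm{glob}}(x,\xi)=\xi(x)^*(A\xi)(x)\in\mathbb C^{d_\xi\times d_\xi}$, where $A\xi(x)=(A\xi_{ij}(x))_{i,j=1}^{d_\xi}$ is obtained by applying $A$ entrywise. *)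

(* Defs.v *)
From HB Require Import structures.
From mathcomp Require Import all_boot all_order all_algebra.
From mathcomp Require Import complex.
From mathcomp Require Import all_classical all_reals all_analysis.

Set Implicit Arguments.
Unset Strict Implicit.
Unset Printing Implicit Defensive.

Import Order.TTheory GRing.Theory Num.Theory.
Import numFieldNormedType.Exports.

Local Open Scope classical_set_scope.
Local Open Scope ring_scope.
Local Open Scope complex_scope.

Section Euclidean.
Context {R : realType}.

Fixpoint partial {n : nat} {V : normedModType R} (s : seq 'I_n)
    (f : 'rV[R]_n -> V) : 'rV[R]_n -> V :=
  if s is i :: s' then fun x => 'D_(delta_mx 0 i) (partial s' f) x else f.

(* U is meant to be open; only the values of f near U matter. *)
Definition smooth_on {n : nat} {V : normedModType R} (U : set 'rV[R]_n)
    (f : 'rV[R]_n -> V) : Prop :=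
  forall (s : seq 'I_n) x, U x -> differentiable (partial s f) x.

(* R[i] is not a normed R-module in the library, so complex-valued functions
   are differentiated and integrated through their real and imaginary parts. *)
Definition csmooth_on {n : nat} (U : set 'rV[R]_n) (f : 'rV[R]_n -> R[i]) :
    Prop :=
  smooth_on U (fun x => complex.Re (f x)) /\ smooth_on U (fun x => complex.Im (f x)).

Definition cpartial {n : nat} (s : seq 'I_n) (f : 'rV[R]_n -> R[i])
    (x : 'rV[R]_n) : R[i] :=
  partial s (fun y => complex.Re (f y)) x +i* partial s (fun y => complex.Im (f y)) x.

Definition test_function {n : nat} (U : set 'rV[R]_n) (f : 'rV[R]_n -> R[i]) :
    Prop :=
  csmooth_on setT f /\
  exists K : set 'rV[R]_n,
    [/\ compact K, K `<=` U & forall x, ~ K x -> f x = 0].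

(* Lebesgue integral over R^n as an iterated integral (Fubini); it is only
   applied below to smooth functions decaying faster than any power. *)
Fixpoint rV_integral (n : nat) : ('rV[R]_n -> R) -> R :=
  match n with
  | 0 => fun f => f 0
  | m.+1 => fun f =>
      \int[lebesgue_measure]_t
        rV_integral (fun v : 'rV[R]_m => f (row_mx (t%:M : 'rV[R]_1) v))
  end.

Definition rV_cintegral (n : nat) (f : 'rV[R]_n -> R[i]) : R[i] :=
  rV_integral (fun x => complex.Re (f x)) +i* rV_integral (fun x => complex.Im (f x)).

Definition dot {n : nat} (x y : 'rV[R]_n) : R := \sum_(i < n) x 0 i * y 0 i.

Definition expi (t : R) : R[i] := cos t +i* sin t.

Definition fourier {n : nat} (u : 'rV[R]_n -> R[i]) (xi : 'rV[R]_n) : R[i] :=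
  rV_cintegral (fun x => expi (- dot x xi) * u x).

(* A symbol a(x, xi) is given as a function of the concatenated vector. *)
Definition Op {n : nat} (a : 'rV[R]_(n + n) -> R[i]) (u : 'rV[R]_n -> R[i])
    (x : 'rV[R]_n) : R[i] :=
  (((2 * pi) ^- n)%:C) *
  rV_cintegral (fun xi => expi (dot x xi) * a (row_mx x xi) * fourier u xi).

(* S^m_{1,0}(R^n x R^n).  The exponent counts the derivatives taken in xi,
   i.e. those with respect to a variable of index at least n.  `|xi| is the
   sup norm; any other norm gives the same class. *)
Definition symbol_class {n : nat} (m : R) (a : 'rV[R]_(n + n) -> R[i]) : Prop :=
  csmooth_on setT a /\
  forall s : seq 'I_(n + n), exists C : R, forall x xi : 'rV[R]_n,
    ComplexField.Normc.normc (cpartial s a (row_mx x xi)) <=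
    C * (1 + `|xi|) `^ (m - (count (fun k : 'I_(n + n) => (n <= k)%N) s)%:R).

End Euclidean.

(* chart_inv is only relevant on chart_codom; chart_map on chart_dom. *)
Record chart (R : realType) (n : nat) (M : topologicalType) := Chart {
  chart_dom : set M;
  chart_map :> M -> 'rV[R]_n;
  chart_inv : 'rV[R]_n -> M;
  chart_codom := chart_map @` chart_dom;
  chart_dom_open : open chart_dom;
  chart_codom_open : open chart_codom;
  chart_mapK : forall x, chart_dom x -> chart_inv (chart_map x) = x;
  chart_map_continuous : forall x, chart_dom x -> {for x, continuous chart_map};
  chart_inv_continuous :
    forall u, chart_codom u -> {for u, continuous chart_inv}
}.

Section Manifold.
Context {R : realType} {n : nat} {M : topologicalType}.
Implicit Types (atlas : set (chart R n M)) (c : chart R n M).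

Definition smooth_transition c c' : Prop :=
  smooth_on [set u | chart_codom c u /\ chart_dom c' (chart_inv c u)]
            (fun u => c' (chart_inv c u)).

Definition smooth_atlas atlas : Prop :=
  (forall x, exists2 c, atlas c & chart_dom c x) /\
  (forall c c', atlas c -> atlas c' -> smooth_transition c c').

(* The charts of the maximal atlas; their domains need not be connected. *)
Definition smooth_chart atlas c : Prop :=
  forall c', atlas c' -> smooth_transition c c' /\ smooth_transition c' c.

Definition Cinf atlas (f : M -> R[i]) : Prop :=
  forall c, atlas c -> csmooth_on (chart_codom c) (fun u => f (chart_inv c u)).

(* Convergence in C^oo(M): all derivatives in charts converge uniformly on
   compact sets. *)
Definition Cinf_cvg atlas (f_ : nat -> M -> R[i]) (f : M -> R[i]) : Prop :=
  forall c, atlas c ->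
  forall K : set 'rV[R]_n, compact K -> K `<=` chart_codom c ->
  forall (s : seq 'I_n) (e : R), 0 < e ->
  \forall k \near \oo, forall u, K u ->
    ComplexField.Normc.normc
      (cpartial s (fun v => f_ k (chart_inv c v)) u -
       cpartial s (fun v => f (chart_inv c v)) u) <= e.

Definition pullback c (v : 'rV[R]_n -> R[i]) : M -> R[i] :=
  patch (fun=> 0) (chart_dom c) (fun x => v (c x)).

(* Psi^m(M) for a compact manifold M, following Hörmander's Definition 18.1.20
   ("The Analysis of Linear Partial Differential Operators III").  Charts with
   disconnected domain are allowed, so that pseudo-locality is included.
   An operator on C^oo(M) is represented by a total map on M -> C whose values
   outside C^oo(M) are irrelevant.  Since C^oo(M) is metrizable, sequential
   continuity is continuity. *)
Record pseudo_differential atlas (m : R) (A : (M -> R[i]) -> (M -> R[i])) :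
    Prop := {
  pdo_Cinf : forall f, Cinf atlas f -> Cinf atlas (A f);
  pdo_linear : forall (a : R[i]) f g, Cinf atlas f -> Cinf atlas g ->
    forall x, A (fun y => a * f y + g y) x = a * A f x + A g x;
  pdo_continuous : forall (f_ : nat -> M -> R[i]) f,
    (forall k, Cinf atlas (f_ k)) -> Cinf atlas f ->
    Cinf_cvg atlas f_ f -> Cinf_cvg atlas (fun k => A (f_ k)) (A f);
  pdo_local : forall c, smooth_chart atlas c ->
    forall phi psi : 'rV[R]_n -> R[i],
    test_function (chart_codom c) phi -> test_function (chart_codom c) psi ->
    exists2 a : 'rV[R]_(n + n) -> R[i], symbol_class m a &
      forall u, test_function setT u -> forall x,
        phi x * A (pullback c (fun y => psi y * u y)) (chart_inv c x) =
        Op a u x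
}.

End Manifold.

(* The library's measurable types are pointed; the distinguished point carried
   by PointedTopological plays no role. *)
#[short(type="preTopologicalGroupType")]
HB.structure Definition PreTopologicalGroup :=
  {G of Group G & PointedTopological G}.

Record lie_group (R : realType) (n : nat) (G : preTopologicalGroupType)
    (atlas : set (chart R n G)) : Prop := {
  lie_hausdorff : hausdorff_space G;
  lie_second_countable : @second_countable G;
  lie_atlas : smooth_atlas atlas;
  lie_mul_continuous : continuous (fun p : G * G => (p.1 * p.2)%g);
  lie_inv_continuous : continuous (fun x : G => (x^-1)%g);
  lie_mul_smooth : forall c1 c2 c3, atlas c1 -> atlas c2 -> atlas c3 ->
    let mul (w : 'rV[R]_(n + n)) :=
      (chart_inv c1 (lsubmx w) * chart_inv c2 (rsubmx w))%g in
    smooth_on [set w | [/\ chart_codom c1 (lsubmx w),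
                           chart_codom c2 (rsubmx w) & chart_dom c3 (mul w)]]
              (fun w => c3 (mul w));
  lie_inv_smooth : forall c1 c2, atlas c1 -> atlas c2 ->
    let inv (u : 'rV[R]_n) := ((chart_inv c1 u)^-1)%g in
    smooth_on [set u | chart_codom c1 u /\ chart_dom c2 (inv u)]
              (fun u => c2 (inv u))
}.

Notation borelType T := (g_sigma_algebraType (@open T)).

(* On a compact Lie group, which is metrizable, every Borel probability measure
   is regular, so this determines the normalised Haar measure. *)
Definition normalised_haar (R : realType) (G : preTopologicalGroupType)
    (mu : probability (borelType G) R) : Prop :=
  forall (g : G) (B : set (borelType G)), measurable B ->
    mu ((fun x : G => (g * x)%g) @^-1` B) = mu B.

Definition cintegral (R : realType) (G : preTopologicalGroupType)
    (mu : probability (borelType G) R) (f : G -> R[i]) : R[i] :=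
  (\int[mu]_x complex.Re (f x)) +i* (\int[mu]_x complex.Im (f x)).

Definition inner (R : realType) (G : preTopologicalGroupType)
    (mu : probability (borelType G) R) (f h : G -> R[i]) : R[i] :=
  cintegral mu (fun x => f x * Num.conj (h x)).

(* Irreducibility: the subspaces of C^d are the row spaces of matrices U, and
   xi(x) acts on a column vector v^T as v *m (xi x)^T. *)
Record unitary_irrep (R : realType) (G : preTopologicalGroupType) (d : nat)
    (xi : G -> 'M[R[i]]_d) : Prop := {
  irrep_continuous : forall i j,
    continuous (fun x => complex.Re (xi x i j)) /\
    continuous (fun x => complex.Im (xi x i j));
  irrep_one : xi 1%g = 1%:M;
  irrep_mul : forall x y, xi (x * y)%g = xi x *m xi y;
  irrep_unitary : forall x, xi x \is unitarymx;
  irrep_dim : (0 < d)%N;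
  irrep_irreducible : forall U : 'M[R[i]]_d,
    (forall x, stablemx U (xi x)^T) -> U = 0 \/ row_full U
}.

Definition global_symbol (R : realType) (G : preTopologicalGroupType) (d : nat)
    (A : (G -> R[i]) -> (G -> R[i])) (x : G) (xi : G -> 'M[R[i]]_d) :
    'M[R[i]]_d :=
  (xi x)^t*%sesqui *m \matrix_(i, j) A (fun y => xi y i j) x.

(* Main.v *)
From HB Require Import structures.
Require Import Defs.
From mathcomp Require Import all_boot all_order all_algebra.
From mathcomp Require Import complex.
From mathcomp Require Import all_classical all_reals all_analysis.
From mathcomp Require Import ring.

Set Implicit Arguments.
Unset Strict Implicit.
Unset Printing Implicit Defensive.

Import Order.TTheory GRing.Theory Num.Theory.
Import numFieldNormedType.Exports.
Local Open Scope classical_set_scope.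
Local Open Scope ring_scope.
Local Open Scope complex_scope.

(** Pointwise, the trace of [xi(x)^* (A xi)(x)] is the finite sum over [i, j] of
[A xi_ij (x)] times the conjugate of [xi_ij (x)], so the identity only exchanges
a finite sum with the Haar integral.  The substance is that each summand is
integrable, and since [A] is controlled on smooth functions only, this requires
the matrix coefficients of a merely continuous representation to be smooth
([rep_Cinf]).  Then every [A xi_ij] is smooth, hence continuous, and continuous
functions on a compact group are integrable.

Smoothness is obtained by averaging, following Garding.  For a function [f] put
[M(f)] for the integral of [f(y) xi(y) dy].  Left invariance gives
[M(f(x .)) = xi(x^-1) M(f)] ([rep_avg_translate]).  If [f] is a nonnegative bump
concentrated where [xi] is close to the identity, [M(f)] is a small perturbation
of a positive scalar matrix, hence invertible ([rep_avg_unitmx]); positivity of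
the integral of [f] comes from covering [G] by finitely many translates
([Int_gt0]).  Then [xi(x)] is the adjoint of [M(f(x .)) M(f)^-1], whose
dependence on [x] sits in [f] alone and is differentiated under the integral
sign ([Ck_Int]).

Since smoothness is differentiability of every order, a bump of class [C^k] for
each finite [k] suffices: a power of the positive part of
[s^2 - |c(z) - c(1)|^2] in a chart [c] at the identity ([bump]).  Functions of a
group element [y] and of the coordinates [u] of [x] are handled by the class
[Ck] of functions with [k] continuous derivatives in [u], jointly continuous in
[(u, y)]. *)

(** * Differential calculus with a parameter *)

Section Differentiability.
Context {R : realType} {V W : normedModType R}.

(** The epsilon form of the little-o condition, with the candidate [L] for the
differential given; it identifies the differential at the same time. *)
Lemma differentiable_approx (f : V -> W) (L : {linear V -> W}) (x : V) :
  continuous L ->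
  (forall e : R, 0 < e -> \forall h \near (0 : V), `|f (h + x) - f x - L h| <= e * `|h|) ->
  differentiable f x /\ ('d f x = L :> (V -> W)).
Proof.
move=> cL H.
have E : f \o shift x = cst (f x) + L +o_ (0 : V) id.
  apply/eqaddoP => e e0.
  have := H _ e0; apply: filter_app; near=> h => /=.
  by rewrite -[((_ \o _) - _) h]/(f (h + x) - (f x + L h)) opprD addrA.
have dE : 'd f x = L :> (V -> W) by apply: diff_unique.
by split => //; apply/diff_locallyP; rewrite dE; split.
Unshelve. all: by end_near. Qed.

Lemma near_eq_differentiable (f g : V -> W) (x : V) :
  (\forall z \near x, f z = g z) -> differentiable f x -> differentiable g x.
Proof.
move=> fg df.
suff H e : 0 < e ->
    \forall h \near (0 : V), `|g (h + x) - g x - 'd f x h| <= e * `|h|.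
  by have [] := differentiable_approx (diff_continuous df) H.
move=> e0; have /diff_locally /eqaddoP /(_ _ e0) := df.
have : \forall h \near (0 : V), f (h + x) = g (h + x).
  by move: (fg); rewrite (near_shift 0 x) subr0.
apply: filter_app2; near=> h => fgh /=.
rewrite -[((_ \o _) - _) h]/(f (h + x) - (f x + 'd f x h)) opprD addrA.
by rewrite fgh (nbhs_singleton fg).
Unshelve. all: by end_near. Qed.

End Differentiability.

Section PositivePart.
Context {R : realType}.

(** The function [t_+^(k+1)], of class [C^k]; the exponent is shifted so that [k]
counts the available derivatives. *)
Definition pospow (k : nat) (t : R) : R := Num.max 0 t ^+ k.+1.

(** Away from 0 the function is locally constant or a monomial; at 0 it is
bounded by [|h|^(k+2)], so its differential vanishes there. *)
Lemma pospow_differentiable (k : nat) (t : R) :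
  differentiable (pospow k.+1) t /\
  forall v, 'd (pospow k.+1) t v = k.+2%:R * pospow k t * v.
Proof.
have [t0|t0|t0] := ltrgtP t 0.
- have E : \forall z \near t, cst (0 : R) z = pospow k.+1 z.
    have : \forall z \near t, z < 0 by exact: lt_nbhsl.
    apply: filterS => z z0; rewrite /pospow max_l ?ltW// expr0n //.
  split; first exact: near_eq_differentiable E (differentiable_cst _ _).
  move=> v; rewrite -deriveE; last exact: near_eq_differentiable E (differentiable_cst _ _).
  by rewrite -(near_eq_derive _ E) derive_cst /pospow max_l ?ltW// expr0n mulr0 mul0r.
- have E : \forall z \near t, z ^+ k.+2 = pospow k.+1 z.
    have : \forall z \near t, 0 < z by exact: lt_nbhsr.
    by apply: filterS => z z0; rewrite /pospow max_r ?ltW.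
  have D : differentiable (fun z : R => z ^+ k.+2) t.
    exact/derivable1_diffP/exprn_derivable.
  split; first exact: near_eq_differentiable E D.
  move=> v; rewrite -deriveE; last exact: near_eq_differentiable E D.
  by rewrite -(near_eq_derive _ E) exp_derive /pospow max_r ?ltW.
- rewrite t0.
  have c0 : continuous (\0 : R -> R) by move=> x; exact: cvg_cst.
  suff H e : 0 < e -> \forall h \near (0 : R),
      `|pospow k.+1 (h + 0) - pospow k.+1 0 - \0 h| <= e * `|h|.
    have [D1 D2] := @differentiable_approx _ _ _ _ \0 0 c0 H.
    by split => // v; rewrite D2 /pospow maxxx expr0n mulr0 mul0r.
  move=> e0; have : \forall h \near (0:R), `|h| < Num.min 1 e.
      have := @nbhs0_lt _ R (Num.min 1 e); apply; by rewrite lt_min ltr01.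
  apply: filterS => h; rewrite lt_min => /andP[h1 he].
  rewrite addr0 /pospow maxxx expr0n !subr0.
  have [h0|h0] := lerP 0 h; last first.
    by rewrite expr0n normr0 mulr_ge0 // ltW.
  rewrite normrX exprS mulrC ler_wpM2r// exprS.
  by apply: le_trans (ltW he); rewrite ler_piMr// exprn_ile1// ltW.
Qed.

End PositivePart.

Section ParametricSmoothness.
Context {R : realType} {n : nat} {T : topologicalType}.

Definition pder {V : normedModType R} (i : 'I_n) (K : 'rV[R]_n -> T -> V) :
  'rV[R]_n -> T -> V := fun u y => 'D_(delta_mx 0 i) (K^~ y) u.

(** Only derivatives in the Euclidean variable [u] are taken: the point [y] of [T]
is a parameter.  Joint continuity of all derivatives is what makes them uniform
in [y] when [T] is compact.  Differentiability is required besides the existence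
of continuous partial derivatives, so that [smooth_on] can be read off. *)
Fixpoint Ck {V : normedModType R} (Omega : set ('rV[R]_n * T)) (k : nat)
    (K : 'rV[R]_n -> T -> V) : Prop :=
  (forall p, Omega p -> {for p, continuous (fun p => K p.1 p.2)}) /\
  if k is k'.+1 then
    (forall p, Omega p -> differentiable (K^~ p.2) p.1) /\
    (forall i, Ck Omega k' (pder i K))
  else True.

Lemma Ck_continuous {V : normedModType R} Omega k (K : 'rV[R]_n -> T -> V) :
  Ck Omega k K -> forall p, Omega p -> {for p, continuous (fun p => K p.1 p.2)}.
Proof. by case: k => [|k] []. Qed.

Lemma CkW {V : normedModType R} Omega k (K : 'rV[R]_n -> T -> V) :
  Ck Omega k.+1 K -> Ck Omega k K.
Proof.
elim: k K => [|k IH] K; first by case.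
by move=> [cK [dK H]]; split=> //; split=> // i; apply/IH/H.
Qed.

Lemma Ck_local {V : normedModType R} Omega k (K : 'rV[R]_n -> T -> V) :
  (forall p, Omega p -> exists2 Omega' : set _, Omega' p & Ck Omega' k K) ->
  Ck Omega k K.
Proof.
elim: k K => [|k IH] K H.
  by split => [p /H[D Dp [cK _]]|//]; exact: cK.
split=> [p /H[D Dp [cK _]]|]; first exact: cK.
split=> [p /H[D Dp [_ [dK _]]]|i]; first exact: dK.
by apply: IH => p /H[D Dp [_ [_ HK]]]; exists D => //; exact: HK.
Qed.

Lemma open_section (Omega : set ('rV[R]_n * T)) p : open Omega -> Omega p ->
  \forall u \near p.1, Omega (u, p.2).
Proof.
case: p => u y /= oO Op.
have [[A B] [/= Au By] AB] : nbhs (u, y) Omega by exact: open_nbhs_nbhs.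
near=> v; apply: AB; split => /=; first by near: v.
exact: nbhs_singleton.
Unshelve. all: by end_near. Qed.

(** Openness of [Omega] lets the equality be differentiated. *)
Lemma Ck_eq {V : normedModType R} Omega k (K K' : 'rV[R]_n -> T -> V) :
  open Omega -> (forall p, Omega p -> K p.1 p.2 = K' p.1 p.2) ->
  Ck Omega k K -> Ck Omega k K'.
Proof.
move=> oO; elim: k K K' => [|k IH] K K' KK'.
  move=> [cK _]; split=> // p Op.
  have E : \forall q \near p, K q.1 q.2 = K' q.1 q.2.
    by have := open_nbhs_nbhs (conj oO Op); apply: filterS => q /KK'.
  rewrite /prop_for /continuous_at -KK'//.
  by apply: cvg_trans (cK _ Op); exact: near_eq_cvg.
move=> [cK [dK HK]]; split.
  move=> p Op.
  have E : \forall q \near p, K q.1 q.2 = K' q.1 q.2.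
    by have := open_nbhs_nbhs (conj oO Op); apply: filterS => q /KK'.
  rewrite /prop_for /continuous_at -KK'//.
  by apply: cvg_trans (cK _ Op); exact: near_eq_cvg.
have E p : Omega p -> \forall u \near p.1, K u p.2 = K' u p.2.
  by move=> Op; have := open_section oO Op; apply: filterS => u /KK'.
split=> [p Op|i]; first exact: near_eq_differentiable (E p Op) (dK _ Op).
apply: IH (HK i) => p Op; exact: near_eq_derive (E p Op).
Qed.

Lemma Ck_cst {V : normedModType R} Omega k (g : T -> V) : continuous g ->
  Ck Omega k (fun _ y => g y).
Proof.
move=> cg; elim: k g cg => [|k IH] g cg.
  by split=> // p _; apply: continuous_comp (cg _); exact: cvg_snd.
split=> [p _|].
  by apply: continuous_comp (cg _); exact: cvg_snd.
split=> [p _|i]; first exact: differentiable_cst.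
rewrite (_ : pder _ _ = fun _ _ => 0); first by apply: IH => y; exact: cvg_cst.
by apply/funext => u; apply/funext => y; rewrite /pder derive_cst.
Qed.

Lemma CkD {V : normedModType R} Omega k (K L : 'rV[R]_n -> T -> V) :
  open Omega -> Ck Omega k K -> Ck Omega k L ->
  Ck Omega k (fun u y => K u y + L u y).
Proof.
move=> oO; elim: k K L => [|k IH] K L.
  by move=> [cK _] [cL _]; split=> // p Op; apply: cvgD; [exact: cK|exact: cL].
move=> [cK [dK HK]] [cL [dL HL]]; split.
  by move=> p Op; apply: cvgD; [exact: cK|exact: cL].
split=> [p Op|i]; first exact: (differentiableD (dK _ Op) (dL _ Op)).
apply: Ck_eq oO _ (IH _ _ (HK i) (HL i)) => p Op.
by rewrite /pder -deriveD //; apply: diff_derivable; [exact: dK|exact: dL].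
Qed.

Lemma Ck_sum {V : normedModType R} Omega k (I : finType) (K : I -> 'rV[R]_n -> T -> V) :
  open Omega -> (forall i, Ck Omega k (K i)) ->
  Ck Omega k (fun u y => \sum_i K i u y).
Proof.
move=> oO H.
suff S (r : seq I) : Ck Omega k (fun u y => \sum_(i <- r) K i u y) by exact: S.
elim: r => [|i r IH].
  rewrite (_ : (fun _ _ => _) = fun _ _ => 0).
    by apply: Ck_cst => y; exact: cvg_cst.
  by apply/funext => u; apply/funext => y; rewrite big_nil.
rewrite (_ : (fun _ _ => _) = fun u y => K i u y + \sum_(j <- r) K j u y).
  exact: CkD.
by apply/funext => u; apply/funext => y; rewrite big_cons.
Qed.

Lemma CkM Omega k (K L : 'rV[R]_n -> T -> R) :
  open Omega -> Ck Omega k K -> Ck Omega k L ->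
  Ck Omega k (fun u y => K u y * L u y).
Proof.
move=> oO; elim: k K L => [|k IH] K L.
  by move=> [cK _] [cL _]; split=> // p Op; apply: cvgM; [exact: cK|exact: cL].
move=> CK CL; move: (CK) (CL) => [cK [dK HK]] [cL [dL HL]]; split.
  by move=> p Op; apply: cvgM; [exact: cK|exact: cL].
split=> [p Op|i]; first exact: (differentiableM (dK _ Op) (dL _ Op)).
apply: Ck_eq oO _ (CkD oO (IH _ _ (CkW CK) (HL i)) (IH _ _ (HK i) (CkW CL))).
move=> p Op; rewrite /pder.
rewrite -[RHS]/('D_(delta_mx 0 i) ((K^~ p.2) * (L^~ p.2)) p.1).
rewrite deriveM; last 2 first.
- by apply: diff_derivable; exact: dK.
- by apply: diff_derivable; exact: dL.
by congr (_ + _); rewrite mulrC.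
Qed.

(** The derivative of [K_+^(k+2)] is [(k+2) K_+^(k+1)] times that of [K], which
has one order less in both the exponent and the smoothness of [K]. *)
Lemma Ck_pospow Omega k (K : 'rV[R]_n -> T -> R) :
  open Omega -> Ck Omega k K -> Ck Omega k (fun u y => pospow k (K u y)).
Proof.
move=> oO; have pc m : continuous (pospow m : R -> R).
  move=> t; have cmax : {for t, continuous (fun s : R => Num.max 0 s)}.
    by apply: (@continuous_max _ _ (cst 0) id); [exact: cvg_cst|exact: cvg_id].
  exact: (continuous_comp cmax (@exprn_continuous _ m.+1 _)).
elim: k K => [|k IH] K CK.
  split=> // p Op; apply: continuous_comp (pc _ _).
  exact: (Ck_continuous CK).
split.
  move=> p Op; apply: continuous_comp (pc _ _).
  exact: (Ck_continuous CK).
have [cK [dK HK]] := CK.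
have dP p : Omega p -> differentiable (fun u => pospow k.+1 (K u p.2)) p.1.
  move=> Op; apply: (@differentiable_comp _ _ _ _ (K^~ p.2)); first exact: dK.
  by have [] := pospow_differentiable k (K p.1 p.2).
split=> // i.
have C2 : continuous (fun _ : T => k.+2%:R : R) by move=> y; exact: cvg_cst.
have := CkM oO (CkM oO (Ck_cst Omega k C2) (IH _ (CkW CK))) (HK i).
apply: Ck_eq oO _ => p Op.
have [d1 d2] := pospow_differentiable k (K p.1 p.2).
rewrite /pder [RHS]deriveE; last exact: dP.
rewrite deriveE; last exact: dK.
by rewrite (@diff_comp _ _ _ _ (K^~ p.2) (pospow k.+1)) //= ?d2 //; exact: dK.
Qed.

Lemma Ck_coord m Omega k (K : 'rV[R]_n -> T -> 'rV[R]_m) j :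
  open Omega -> Ck Omega k K -> Ck Omega k (fun u y => K u y 0 j).
Proof.
move=> oO; elim: k K => [|k IH] K.
  move=> [cK _]; split=> // p Op.
  exact: (continuous_comp (cK _ Op) (@coord_continuous _ _ _ 0 j _)).
move=> [cK [dK HK]]; split.
  move=> p Op.
  exact: (continuous_comp (cK _ Op) (@coord_continuous _ _ _ 0 j _)).
have dP p : Omega p -> differentiable (fun u => K u p.2 0 j) p.1.
  move=> Op.
  exact: (differentiable_comp (dK _ Op) (differentiable_coord _ 0 j)).
split=> // i; apply: Ck_eq oO _ (IH _ (HK i)) => p Op.
rewrite /pder derive_mx ?mxE //.
by apply: diff_derivable; exact: dK.
Qed.

End ParametricSmoothness.

(** * Smooth functions on Euclidean space *)

Section Smooth.
Context {R : realType}.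

Lemma cvg_rV {I : Type} (F : set_system I) {FF : Filter F} n (f : I -> 'rV[R]_n)
    (l : 'rV[R]_n) :
  (forall j, (fun t => f t 0 j) @ F --> l 0 j) -> f @ F --> l.
Proof.
move=> H; apply/cvg_ballP => e e0.
have : \forall t \near F, forall j, ball (l 0 j) e (f t 0 j).
  by apply: filter_forall => k; exact: (cvg_ball (H k)).
by apply: filterS => t Ht; split => // i j; rewrite ord1.
Qed.

Lemma row_mx_linear n m : linear (fun u : 'rV[R]_n => row_mx u (0 : 'rV[R]_m)).
Proof. by move=> a u v; rewrite scale_row_mx add_row_mx scaler0 addr0. Qed.


Lemma continuous_row_mx {T : topologicalType} n m (f : T -> 'rV[R]_n)
    (q : T -> 'rV[R]_m) (x : T) :
  {for x, continuous f} -> {for x, continuous q} ->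
  {for x, continuous (fun t => row_mx (f t) (q t))}.
Proof.
move=> cf cq; apply: cvg_rV => j; case: (split_ordP j) => k ->.
  rewrite (_ : (fun t => _) = fun t => f t 0 k); last first.
    by apply/funext => t; rewrite row_mxEl.
  rewrite row_mxEl; exact: (continuous_comp cf (@coord_continuous _ _ _ 0 k _)).
rewrite (_ : (fun t => _) = fun t => q t 0 k); last first.
  by apply/funext => t; rewrite row_mxEr.
rewrite row_mxEr; exact: (continuous_comp cq (@coord_continuous _ _ _ 0 k _)).
Qed.

Lemma differentiable_row_mx n m (v : 'rV[R]_m) (u : 'rV[R]_n) :
  differentiable (fun u : 'rV[R]_n => row_mx u v) u.
Proof.
pose lM := GRing.isLinear.Build _ _ _ _ _ (@row_mx_linear n m).
pose L : {linear _ -> _} := HB.pack (fun u : 'rV[R]_n => row_mx u (0 : 'rV[R]_m)) lM.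
have dL : differentiable (fun u : 'rV[R]_n => row_mx u (0 : 'rV[R]_m)) u.
  apply: (@linear_differentiable _ _ _ L) => w.
  have cw : {for w, continuous (id : 'rV[R]_n -> 'rV[R]_n)} by exact: cvg_id.
  exact: (continuous_row_mx cw (@cst_continuous _ _ (0 : 'rV[R]_m) w)).
rewrite (_ : row_mx^~ v = (fun u : 'rV[R]_n => row_mx u (0 : 'rV[R]_m)) + cst (row_mx 0 v)).
  exact: differentiableD dL (differentiable_cst _ _).
by apply/funext => w; rewrite -[RHS]/(row_mx w 0 + row_mx 0 v) add_row_mx add0r addr0.
Qed.

(** The partial derivatives in [u] of [h (row_mx u (q y))] are the partial
derivatives of [h] in its first [n] variables, so a smooth function of two
points of which the second is read in a continuous chart [q] lies in every
[Ck]. *)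
Lemma smooth_Ck {T : topologicalType} {V : normedModType R} n m
    (W : set 'rV[R]_(n + m)) (h : 'rV[R]_(n + m) -> V) (q : T -> 'rV[R]_m)
    (Omega : set ('rV[R]_n * T)) k :
  open Omega -> smooth_on W h ->
  (forall p, Omega p -> W (row_mx p.1 (q p.2)) /\ {for p.2, continuous q}) ->
  Ck Omega k (fun u y => h (row_mx u (q y))).
Proof.
move=> oO sh HO.
(* the induction on k runs over all iterated derivatives of h *)
suff S s : Ck Omega k (fun u y => partial s h (row_mx u (q y))) by exact: (S [::]).
move: s; have cP s p : Omega p ->
    {for p, continuous (fun p => partial s h (row_mx p.1 (q p.2)))}.
  move=> Op; have [Wp cq] := HO _ Op.
  have cr : {for p, continuous (fun p : 'rV[R]_n * T => row_mx p.1 (q p.2))}.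
    apply: continuous_row_mx; first exact: cvg_fst.
    have c2 : {for p, continuous (@snd 'rV[R]_n T)} by exact: cvg_snd.
    exact: (continuous_comp c2 cq).
  exact: (continuous_comp cr (differentiable_continuous (sh s _ Wp))).
elim: k => [|k IH] s; first by split=> // p; exact: cP.
split=> [p|]; first exact: cP.
split=> [p Op|i].
  have [Wp _] := HO _ Op.
  exact: (differentiable_comp (differentiable_row_mx (q p.2) p.1) (sh s _ Wp)).
rewrite (_ : pder _ _ = fun u y => partial (lshift m i :: s) h (row_mx u (q y))).
  exact: IH.
apply/funext => u; apply/funext => y; rewrite /pder /=.
(* both derivatives are limits of the same difference quotient *)
have E : (fun t : R => t^-1 *: (((fun v => partial s h (row_mx v (q y)))
      \o shift u) (t *: delta_mx 0 i) - partial s h (row_mx u (q y)))) =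
    (fun t => t^-1 *: ((partial s h \o shift (row_mx u (q y)))
      (t *: delta_mx 0 (lshift m i)) - partial s h (row_mx u (q y)))).
  apply/funext => t; congr (_ *: (partial s h _ - _)) => /=.
  rewrite -[t *: delta_mx 0 (lshift m i)](_ : row_mx (t *: delta_mx 0 i) 0 = _).
    by rewrite add_row_mx add0r.
  by rewrite delta_mx_lshift scale_row_mx scaler0.
by rewrite /derive E.
Qed.

(** A function of [u] alone is treated as constant in [T], which has to be
inhabited for the conclusion to follow. *)
Lemma Ck_smooth {T : topologicalType} {V : normedModType R} n (U : set 'rV[R]_n)
    (y : T) (f : 'rV[R]_n -> V) :
  (forall k, Ck (U `*` [set: T]) k (fun u _ => f u)) -> smooth_on U f.
Proof.
move=> H.
suff S s k : Ck (U `*` [set: T]) k (fun u _ => partial s f u).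
  by move=> s x Ux; have [_ [/(_ (x, y) (conj Ux I))]] := S s 1%N.
elim: s k => [|i s IH] k; first exact: H.
by have [_ [_ /(_ i)]] := IH k.+1.
Qed.

End Smooth.

(** * Integration over a compact space *)

Lemma continuous_section {S T V : topologicalType} (K : S -> T -> V) u y :
  {for (u, y), continuous (fun p => K p.1 p.2)} -> {for y, continuous (K u)}.
Proof.
move=> cK A /cK [[B C] /= [Bu Cy] BC]; apply: filterS Cy => z Cz.
by apply: (BC (u, z)); split => //; exact: nbhs_singleton.
Qed.

Lemma continuous_sumr {R : realType} {T : topologicalType} (I : Type) (r : seq I)
    (f : I -> T -> R) :
  (forall i, continuous (f i)) -> continuous (fun x => \sum_(i <- r) f i x).
Proof.
move=> cf; elim: r => [|i r IH] x.
  rewrite (_ : (fun x => _) = fun=> 0); first exact: cvg_cst.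
  by apply/funext => y; rewrite big_nil.
rewrite (_ : (fun x => _) = fun x => f i x + \sum_(j <- r) f j x).
  exact: cvgD (cf i x) (IH x).
by apply/funext => y; rewrite big_cons.
Qed.

Section Integral.
Context {R : realType} {G : ptopologicalType} (mu : probability (borelType G) R).
Hypothesis cG : compact [set: G].

Lemma continuous_integrable (f : G -> R) : continuous f ->
  mu.-integrable [set: borelType G] (EFin \o (f : borelType G -> R)).
Proof.
move=> cf; apply: measurable_bounded_integrable => //.
- by rewrite -ge0_fin_numE// fin_num_measure.
- apply: (measurability _ (measurable_realfun.RGenOpens.measurableE R)) => //.
  move=> _ [_ [a [b ->] <-]]; rewrite setTI.
  by apply: sub_sigma_algebra; move/continuousP : cf; apply; exact: interval_open.
- have /compact_bounded : compact (f @` [set: G]).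
    by apply: continuous_compact => //; exact: continuous_subspaceT.
  move=> [M [Mr HM]]; exists M; split => // x /HM H t _ /=.
  by apply: H; exists t.
Qed.

Local Notation Int f := (\int[mu]_(x in [set: borelType G]) f x).

Lemma IntD (f g : G -> R) : continuous f -> continuous g ->
  Int (fun x => f x + g x) = Int f + Int g.
Proof. by move=> cf cg; rewrite RintegralD//; exact: continuous_integrable. Qed.

Lemma IntB (f g : G -> R) : continuous f -> continuous g ->
  Int (fun x => f x - g x) = Int f - Int g.
Proof. by move=> cf cg; rewrite RintegralB//; exact: continuous_integrable. Qed.

Lemma IntZ (a : R) (f : G -> R) : continuous f ->
  Int (fun x => a * f x) = a * Int f.
Proof. by move=> cf; rewrite RintegralZl//; exact: continuous_integrable. Qed.

Lemma Int_cst (a : R) : Int (fun=> a) = a.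
Proof.
rewrite Rintegral_cst; last exact: measurableT.
rewrite [X in _ * X](_ : _ = 1) ?mulr1//.
exact: (congr1 fine (probability_setT mu)).
Qed.

Lemma Int_sum (I : Type) (r : seq I) (f : I -> G -> R) :
  (forall i, continuous (f i)) ->
  Int (fun x => \sum_(i <- r) f i x) = \sum_(i <- r) Int (f i).
Proof.
move=> cf; elim: r => [|i r IH].
  rewrite big_nil (_ : (fun x => _) = fun=> 0) ?Int_cst//.
  by apply/funext => x; rewrite big_nil.
rewrite big_cons (_ : (fun x => _) = fun x => f i x + \sum_(j <- r) f j x).
  by rewrite IntD ?IH//; exact: continuous_sumr.
by apply/funext => x; rewrite big_cons.
Qed.

Lemma le_Int (f g : G -> R) : continuous f -> continuous g ->
  (forall x, f x <= g x) -> Int f <= Int g.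
Proof. by move=> cf cg fg; apply: le_Rintegral => //; exact: continuous_integrable. Qed.

Lemma Int_norm_le (f g : G -> R) : continuous f -> continuous g ->
  (forall x, `|f x| <= g x) -> `|Int f| <= Int g.
Proof.
move=> cf cg fg.
have cNg : continuous (fun x => -1 * g x).
  by move=> x; apply: cvgM; [exact: cvg_cst|exact: cg].
rewrite ler_norml; apply/andP; split; last first.
  by apply: le_Int => // x; have := fg x; rewrite ler_norml => /andP[].
rewrite -mulN1r -IntZ//; apply: le_Int => // x.
by have := fg x; rewrite mulN1r ler_norml => /andP[].
Qed.

End Integral.

Section DifferentiationUnderIntegral.
Context {R : realType} {G : ptopologicalType} (mu : probability (borelType G) R).
Hypothesis cG : compact [set: G].
Local Notation Int f := (\int[mu]_(x in [set: borelType G]) f x).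

(** Tube lemma: pointwise continuity along the compact slice [{u} x G] is
uniform. *)
Lemma near_uniform_section {n} (K : 'rV[R]_n -> G -> R) (u : 'rV[R]_n) (e : R) : 0 < e ->
  (forall y, {for (u, y), continuous (fun p => K p.1 p.2)}) ->
  \forall v \near u, forall y, `|K v y - K u y| <= e.
Proof.
move=> e0 cK; have /compact_near_coveringP nc := cG.
have : \forall v \near u, [set: G] `<=` (fun y => `|K v y - K u y| <= e).
  apply: (nc _ (nbhs u) (fun v y => `|K v y - K u y| <= e)) => y _.
  have e2 : 0 < e / 2 by rewrite divr_gt0.
  have /cvgrPdist_le /(_ _ e2) /= [[A B] /= [Au By] AB] := cK y.
  exists (B, A) => //= -[y' v] /= [By' Av].
  have H1 := AB (v, y') (conj Av By').
  have H2 := AB (u, y') (conj (nbhs_singleton Au) By').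
  rewrite [e]splitr -[X in `|X|](_ : (K u y - K u y') - (K u y - K v y') = _).
    by rewrite (le_trans (ler_normB _ _))// lerD.
  by ring.
by apply: filterS => v H y; exact: H.
Qed.

Lemma coord_norm_le n (h : 'rV[R]_n) i : `|h 0 i| <= `|h|.
Proof.
rewrite [leRHS]mx_normrE.
exact: (@le_bigmax _ _ _ 0 (fun ij : 'I_1 * 'I_n => `|h ij.1 ij.2|) (0, i)).
Qed.

Lemma diff_rV n {V : normedModType R} (f : 'rV[R]_n -> V) (u h : 'rV[R]_n) :
  differentiable f u ->
  'd f u h = \sum_i h 0 i *: 'D_(delta_mx 0 i) f u.
Proof.
move=> df; rewrite {1}(row_sum_delta h) linear_sum; apply: eq_bigr => i _.
by rewrite linearZ deriveE.
Qed.

(** Mean value theorem on the segment from [u] to [h + u]: the increment of [f] is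
its differential at an intermediate point, applied to [h]. *)
Lemma segment_estimate n (f : 'rV[R]_n -> R) (u h : 'rV[R]_n) (c : 'I_n -> R) (e : R) :
  (forall t : R, 0 <= t <= 1 -> differentiable f (t *: h + u)) ->
  (forall (t : R) i, 0 <= t <= 1 -> `|'D_(delta_mx 0 i) f (t *: h + u) - c i| <= e) ->
  `|f (h + u) - f u - \sum_i h 0 i * c i| <= n%:R * e * `|h|.
Proof.
move=> df H; pose g (t : R) := f (t *: h + u).
pose dg t := 'd f (t *: h + u) h.
have ag (t : R) : is_diff t (fun t : R => t *: h + u) (fun s : R => s *: h).
  by apply: is_diff_eq; apply/funext => s /=; rewrite addr0.
have gd (t : R) : 0 <= t <= 1 -> is_derive t 1 g (dg t).
  move=> t01; have dt := df _ t01.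
  have D : differentiable g t.
    by apply: (@differentiable_comp _ _ _ _ (fun t : R => t *: h + u)).
  split; first exact: diff_derivable.
  rewrite deriveE // (@diff_comp _ _ _ _ (fun t : R => t *: h + u) f) //=.
  by rewrite diff_val scale1r.
have [||t] := @MVT _ g dg 0 1 ltr01.
- by move=> x /[!in_itv]/= /andP[x0 x1]; apply: gd; rewrite !ltW.
- apply: derivable_within_continuous => x /[!in_itv]/= x01.
  by have [] := gd _ x01.
rewrite in_itv /= => /andP[/ltW t0 /ltW t1].
have t01 : 0 <= t <= 1 by rewrite t0.
rewrite /g scale1r scale0r add0r subr0 mulr1 => ->.
rewrite /dg diff_rV; last exact: df.
rewrite -sumrB (le_trans (ler_norm_sum _ _ _))//.
have -> : n%:R * e * `|h| = \sum_(i < n) (e * `|h|).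
  by rewrite sumr_const card_ord -mulrA mulr_natl.
apply: ler_sum => i _.
rewrite -[_ *: _]/(_ * _) -mulrBr normrM mulrC ler_pM//; first exact: H.
exact: coord_norm_le.
Qed.

(** The first-order expansion of [K (., y)] at [u] has an error at most [e |h|]
with [e] independent of [y], so it may be integrated term by term. *)
Lemma Int_differentiable n (U : set 'rV[R]_n) (K : 'rV[R]_n -> G -> R) :
  open U -> Ck (U `*` [set: G]) 1 K ->
  forall u, U u -> differentiable (fun v => Int (K v)) u /\
    forall i, 'D_(delta_mx 0 i) (fun v => Int (K v)) u = Int (pder i K u).
Proof.
move=> oU [cK [dK HK]] u Uu.
have sec (L : 'rV[R]_n -> G -> R) v :
    (forall p, (U `*` [set: G]) p -> {for p, continuous (fun p => L p.1 p.2)}) ->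
    U v -> continuous (L v).
  by move=> cL Uv y; exact: continuous_section (cL (v, y) (conj Uv I)).
have cKu v : U v -> continuous (K v) by move=> Uv; exact: sec.
have cp i v : U v -> continuous (pder i K v).
  by move=> Uv; apply: sec => // p Up; have [+ _] := HK i; apply.
pose c i := Int (pder i K u).
have linL : linear (fun h : 'rV[R]_n => \sum_i h 0 i * c i : R).
  move=> a h k; rewrite scaler_sumr -big_split; apply: eq_bigr => i _ /=.
  by rewrite !mxE mulrDl -[_ *: (_ * _)]/(_ * (_ * _)) mulrA.
pose lM := GRing.isLinear.Build _ _ _ _ _ linL.
pose L : {linear 'rV[R]_n -> R} := HB.pack (fun h : 'rV[R]_n => \sum_i h 0 i * c i) lM.
have cL : continuous L.
  apply: continuous_sumr => i h.
  exact: cvgM (@coord_continuous _ _ _ 0 i h) (cvg_cst (c i)).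
have app (e : R) : 0 < e ->
    \forall h \near (0 : 'rV[R]_n),
      `|Int (K (h + u)) - Int (K u) - L h| <= e * `|h|.
  (* each of the n coordinates contributes at most e' |h|; dividing by n.+1 keeps
     e' positive when n = 0 *)
  move=> e0; pose e' := e / n.+1%:R.
  have e'0 : 0 < e' by rewrite divr_gt0.
  have : \forall v \near u, U v /\ forall i y, `|pder i K v y - pder i K u y| <= e'.
    have Hp : \forall v \near u, forall i y, `|pder i K v y - pder i K u y| <= e'.
      apply: (@filter_forall _ _
        (fun i v => forall y, `|pder i K v y - pder i K u y| <= e') (nbhs u) _) => i.
      apply: near_uniform_section => // y.
      by have [+ _] := HK i; apply.
    have Up : \forall v \near u, U v by exact: open_nbhs_nbhs.
    by apply: filterS2 Up Hp.
  move=> /nbhs_ballP [r /= r0 Hr].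
  have : \forall h \near (0 : 'rV[R]_n), `|h| < r by exact: nbhs0_lt.
  apply: filterS => h hr.
  have Hs (t : R) : 0 <= t <= 1 -> ball u r (t *: h + u).
    move=> /andP[t0 t1]; rewrite -ball_normE /= opprD addrCA subrr addr0 normrN normrZ.
    by rewrite ger0_norm// (le_lt_trans _ hr)// ler_piMl.
  have Uh : U (h + u) by rewrite -[h]scale1r; apply: (Hr _ (Hs 1 _)).1; rewrite ler01 lexx.
  have cS i : continuous (fun y => h 0 i * pder i K u y).
    by move=> y; apply: cvgM; [exact: cvg_cst|exact: cp].
  have cES : continuous (fun y => \sum_i h 0 i * pder i K u y).
    exact: continuous_sumr.
  have EL : Int (fun y => \sum_i h 0 i * pder i K u y) = \sum_i h 0 i * c i.
    by rewrite Int_sum//; apply: eq_bigr => i _; rewrite IntZ//; exact: cp.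
  rewrite /= -EL.
  rewrite -IntB//; try exact: cKu.
  rewrite -IntB//; last first.
    by move=> y; apply: cvgB; exact: cKu.
  rewrite -[leRHS](Int_cst mu); apply: Int_norm_le => //.
  - by move=> y; apply: cvgB => //; [apply: cvgB; exact: cKu|exact: cES].
  - by move=> y; exact: cvg_cst.
  move=> y; apply: le_trans
    (@segment_estimate n (K^~ y) u h (fun i => pder i K u y) e' _ _) _.
  - by move=> t /Hs/Hr[Ut _]; exact: (dK (_, y)).
  - by move=> t i /Hs/Hr[_ /(_ i y)].
  rewrite ler_wpM2r// /e' mulrCA -[leRHS]mulr1 ler_wpM2l ?ltW//.
  by rewrite ltr_pdivrMr// mul1r ltr_nat.
have [dF EF] := @differentiable_approx _ _ _ (fun v => Int (K v)) L u cL app.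
split=> // i; rewrite deriveE// EF /= (bigD1 i)//= mxE !eqxx mul1r big1 ?addr0//.
by move=> j ji; rewrite mxE eqxx /= (negbTE ji) mul0r.
Qed.

Lemma open_setXT {S : topologicalType} (T : topologicalType) (U : set S) :
  open U -> open (U `*` [set: T]).
Proof.
move=> oU; rewrite openE => -[u y] [/= Uu _]; exists (U, setT) => //.
by split => /=; [exact: open_nbhs_nbhs|exact: filterT].
Qed.

Lemma Ck_Int n (U : set 'rV[R]_n) k (K : 'rV[R]_n -> G -> R) :
  open U -> Ck (U `*` [set: G]) k K ->
  Ck (U `*` [set: G]) k (fun u _ => Int (K u)).
Proof.
move=> oU; have oO := open_setXT (T := G) oU.
elim: k K => [|k IH] K.
  move=> [cK _]; split=> // -[u y] [/= Uu _].
  have cF : {for u, continuous (fun v => Int (K v))}.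
    apply/(@cvgrPdist_le _ _ _ (nbhs u) _) => e e0.
    have T : \forall v \near u, forall y, `|K v y - K u y| <= e.
      by apply: near_uniform_section => // z; exact: cK.
    have oUu : \forall v \near u, U v by exact: open_nbhs_nbhs.
    have cs w : U w -> continuous (K w).
      by move=> Uw z; exact: continuous_section (cK (w, z) (conj Uw I)).
    have near_u : \forall v \near u, `|Int (K u) - Int (K v)| <= e.
      apply: filterS2 oUu T => v /cs cv Tv; have cu := cs _ Uu.
      rewrite distrC -IntB// -[leRHS](Int_cst mu).
      apply: Int_norm_le => // z; last exact: cvg_cst.
      by apply: cvgB; [exact: cv|exact: cu].
    exact: near_u.
  have c1 : {for (u, y), continuous (@fst 'rV[R]_n G)} by exact: cvg_fst.
  exact: (continuous_comp c1 cF).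
move=> CK; have [cK [dK HK]] := CK.
have C1 : Ck (U `*` [set: G]) 1 K.
  by split => //; split => // i; split => // p Up; exact: Ck_continuous (HK i) _ Up.
split.
  move=> [u y] [/= Uu _].
  have c1 : {for (u, y), continuous (@fst 'rV[R]_n G)} by exact: cvg_fst.
  have [dF _] := Int_differentiable oU C1 Uu.
  exact: (continuous_comp c1 (differentiable_continuous dF)).
split=> [[u y] [/= Uu _]|i]; first by have [] := Int_differentiable oU C1 Uu.
apply: Ck_eq oO _ (IH _ (HK i)) => -[u y] [/= Uu _].
by have [_ dInt] := Int_differentiable oU C1 Uu; exact: esym (dInt i).
Qed.

End DifferentiationUnderIntegral.

(** * Complex matrices and complex-valued integrals *)

Section Complex.
Context {R : realType}.

Lemma ReM (z w : R[i]) :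
  complex.Re (z * w) = complex.Re z * complex.Re w - complex.Im z * complex.Im w.
Proof. by case: z w => a b [c d]. Qed.

Lemma ImM (z w : R[i]) :
  complex.Im (z * w) = complex.Re z * complex.Im w + complex.Im z * complex.Re w.
Proof. by case: z w => a b [c d]. Qed.

Lemma ReD (z w : R[i]) : complex.Re (z + w) = complex.Re z + complex.Re w.
Proof. by case: z w => a b [c d]. Qed.

Lemma ImD (z w : R[i]) : complex.Im (z + w) = complex.Im z + complex.Im w.
Proof. by case: z w => a b [c d]. Qed.

Lemma Re_conj (z : R[i]) : complex.Re (Num.conj z) = complex.Re z.
Proof. by case: z. Qed.

Lemma Im_conj (z : R[i]) : complex.Im (Num.conj z) = - complex.Im z.
Proof. by case: z. Qed.

Lemma Re_sum (I : Type) (r : seq I) (F : I -> R[i]) :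
  complex.Re (\sum_(i <- r) F i) = \sum_(i <- r) complex.Re (F i).
Proof. by elim: r => [|i r IH]; rewrite ?big_nil// !big_cons ReD IH. Qed.

Lemma Im_sum (I : Type) (r : seq I) (F : I -> R[i]) :
  complex.Im (\sum_(i <- r) F i) = \sum_(i <- r) complex.Im (F i).
Proof. by elim: r => [|i r IH]; rewrite ?big_nil// !big_cons ImD IH. Qed.

Lemma complex_eq (z w : R[i]) : complex.Re z = complex.Re w ->
  complex.Im z = complex.Im w -> z = w.
Proof. by case: z w => a b [c d] /= -> ->. Qed.

(** Subtracting [c a_k] from the vanishing sum leaves coefficients of size at most
[e].  With [a], [b], [P], [Q] the real and imaginary parts of a vector [v] and of
the [k]-th column of a matrix [M], up to sign and order, the sum is the real or
the imaginary part of the [k]-th coordinate of [v M]. *)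
Lemma dominant_row d (a b P Q : 'I_d -> R) (k : 'I_d) (c e : R) :
  0 <= c -> \sum_i (a i * P i + b i * Q i) = 0 ->
  (forall i, `|P i - c *+ (i == k)| <= e) -> (forall i, `|Q i| <= e) ->
  c * `|a k| <= e * \sum_i (`|a i| + `|b i|).
Proof.
move=> c0 S0 HP HQ.
have E : c * a k = - \sum_i (a i * (P i - c *+ (i == k)) + b i * Q i).
  rewrite (_ : \sum_i _ = \sum_i (a i * P i + b i * Q i) - c * a k); last first.
    rewrite (_ : c * a k = \sum_i a i * (c *+ (i == k))); last first.
      rewrite (bigD1 k)//= eqxx mulr1n big1 ?addr0 1?mulrC// => i /negbTE ->.
      by rewrite mulr0n mulr0.
    by rewrite -sumrB; apply: eq_bigr => i _; ring.
  by rewrite S0 sub0r opprK.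
rewrite -[c in leLHS]ger0_norm// -normrM E normrN mulr_sumr.
apply: le_trans (ler_norm_sum _ _ _) _; apply: ler_sum => i _.
apply: le_trans (ler_normD _ _) _; rewrite !normrM mulrDr.
by rewrite lerD// mulrC ler_wpM2r.
Qed.

(** A vector in the kernel would satisfy [c S <= 2 d e S], where [S] is the sum of
the absolute values of the real and imaginary parts of its coordinates. *)
Lemma near_scalar_unitmx d (M : 'M[R[i]]_d) (c e : R) :
  0 < c -> 2 * d%:R * e < c ->
  (forall i j, `|complex.Re (M i j) - c *+ (i == j)| <= e) ->
  (forall i j, `|complex.Im (M i j)| <= e) -> M \in unitmx.
Proof.
move=> c0 ec HR HI; rewrite unitmxE unitfE; apply/det0P => -[v v0 vM].
pose a i := complex.Re (v 0 i); pose b i := complex.Im (v 0 i).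
pose S := \sum_i (`|a i| + `|b i|).
have HE k : \sum_i v 0 i * M i k = 0.
  by have /rowP/(_ k) := vM; rewrite !mxE.
have bndR k : c * `|a k| <= e * S.
  rewrite /S; under eq_bigr => i _ do rewrite -[`|b i|]normrN.
  apply: (@dominant_row d a (fun i => - b i) (fun i => complex.Re (M i k))
    (fun i => complex.Im (M i k))) => //; first exact: ltW.
  have := congr1 (@complex.Re R) (HE k); rewrite Re_sum; apply: etrans.
  by apply: eq_bigr => i _; rewrite ReM mulNr.
have bndI k : c * `|b k| <= e * S.
  rewrite /S; under eq_bigr => i _ do rewrite addrC.
  apply: (@dominant_row d b a (fun i => complex.Re (M i k))
    (fun i => complex.Im (M i k))) => //; first exact: ltW.
  have := congr1 (@complex.Im R) (HE k); rewrite Im_sum; apply: etrans.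
  by apply: eq_bigr => i _; rewrite ImM addrC.
have S0 : 0 < S.
  rewrite lt_neqAle sumr_ge0 ?andbT; last by move=> i _; rewrite addr_ge0.
  apply: contra_neq v0 => /esym/eqP.
  rewrite psumr_eq0; last by move=> i _; rewrite addr_ge0.
  move=> /allP H; apply/rowP => i; rewrite mxE.
  have := H i (mem_index_enum i); rewrite /= paddr_eq0// !normr_eq0.
  by move=> /andP[/eqP ai /eqP bi]; apply: complex_eq.
have : c * S <= 2 * d%:R * e * S.
  rewrite {1}/S mulr_sumr.
  have -> : 2 * d%:R * e * S = \sum_(i < d) (2 * (e * S)).
    by rewrite sumr_const card_ord -[RHS]mulr_natl; ring.
  by apply: ler_sum => i _; rewrite mulrDr mulr_natl mulr2n lerD.
by rewrite ler_pM2r// leNgt ec.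
Qed.

End Complex.

Section ComplexIntegral.
Context {R : realType} {G : preTopologicalGroupType} (mu : probability (borelType G) R).
Hypothesis cG : compact [set: G].

Definition ccontinuous (f : G -> R[i]) : Prop :=
  continuous (fun x => complex.Re (f x)) /\ continuous (fun x => complex.Im (f x)).

Lemma ccontinuousM f g : ccontinuous f -> ccontinuous g ->
  ccontinuous (fun x => f x * g x).
Proof.
move=> [fR fI] [gR gI]; split.
  under eq_fun do rewrite ReM.
  move=> x; apply: cvgB; first exact: cvgM (fR x) (gR x).
  exact: cvgM (fI x) (gI x).
under eq_fun do rewrite ImM.
move=> x; apply: cvgD; first exact: cvgM (fR x) (gI x).
exact: cvgM (fI x) (gR x).
Qed.

Lemma ccontinuous_conj f : ccontinuous f -> ccontinuous (fun x => Num.conj (f x)).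
Proof.
move=> [fR fI]; split.
  by under eq_fun do rewrite Re_conj.
by under eq_fun do rewrite Im_conj; move=> x; apply: cvgN; exact: fI.
Qed.

Lemma ccontinuous_cst z : ccontinuous (fun=> z).
Proof. by split=> x; exact: cvg_cst. Qed.

Lemma ccontinuous_sum (I : Type) (r : seq I) (f : I -> G -> R[i]) :
  (forall i, ccontinuous (f i)) -> ccontinuous (fun x => \sum_(i <- r) f i x).
Proof.
move=> cf; split.
  under eq_fun do rewrite Re_sum.
  by apply: continuous_sumr => i; have [] := cf i.
under eq_fun do rewrite Im_sum.
by apply: continuous_sumr => i; have [] := cf i.
Qed.

Lemma eq_cintegral f g : f =1 g -> cintegral mu f = cintegral mu g.
Proof. by move=> /funext ->. Qed.

Lemma cintegralZ z f : ccontinuous f ->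
  cintegral mu (fun x => z * f x) = z * cintegral mu f.
Proof.
move=> [fR fI]; have cZ (a : R) (h : G -> R) : continuous h -> continuous (fun x => a * h x).
  by move=> ch x; apply: cvgM; [exact: cvg_cst|exact: ch].
apply: complex_eq; rewrite ?ReM ?ImM /cintegral /=.
  under eq_fun do rewrite ReM.
  by rewrite IntB//; [rewrite !IntZ|exact: cZ|exact: cZ].
under eq_fun do rewrite ImM.
by rewrite IntD//; [rewrite !IntZ|exact: cZ|exact: cZ].
Qed.

Lemma cintegral_sum (I : Type) (r : seq I) (f : I -> G -> R[i]) :
  (forall i, ccontinuous (f i)) ->
  cintegral mu (fun x => \sum_(i <- r) f i x) = \sum_(i <- r) cintegral mu (f i).
Proof.
move=> cf; apply: complex_eq; rewrite ?Re_sum ?Im_sum /cintegral /=.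
  under eq_fun do rewrite Re_sum.
  by rewrite Int_sum// => i; have [] := cf i.
under eq_fun do rewrite Im_sum.
by rewrite Int_sum// => i; have [] := cf i.
Qed.

End ComplexIntegral.

(** * Smoothness of representations of a compact Lie group *)

Section LieGroup.
Context {R : realType} {n : nat} {G : preTopologicalGroupType}.
Variables (atlas : set (chart R n G)) (mu : probability (borelType G) R).
Hypotheses (lG : lie_group atlas) (cG : compact [set: G])
  (haar : normalised_haar mu).

Local Notation Int f := (\int[mu]_x f x).

Lemma lmul_continuous (g : G) : continuous (fun x : G => (g * x)%g).
Proof.
move=> x.
apply: (@continuous_section G G G (fun g x => (g * x)%g) g x).
exact: (lie_mul_continuous lG).
Qed.

(** Invariance of the measure of Borel sets, transported to integrals through the
push-forward of [mu] by the translation. *)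
Lemma Int_translate (g : G) (f : G -> R) : continuous f ->
  Int (fun y => f (g * y)%g) = Int f.
Proof.
move=> cf; have cg : continuous (fun x => (g * x)%g) by exact: lmul_continuous.
have mg : measurable_fun [set: borelType G]
    ((fun x => (g * x)%g : borelType G) : borelType G -> borelType G).
  apply: (@measurability _ _ (borelType G) (borelType G) setT (fun x : G => (g * x)%g) (@open G)) => //.
  move=> _ [B oB <-]; rewrite setTI.
  by apply: sub_sigma_algebra; move/continuousP : cg; apply.
have intfg : mu.-integrable [set: borelType G]
    (EFin \o ((fun y => f (g * y)%g) : borelType G -> R)).
  apply: continuous_integrable => // y.
  exact: (continuous_comp (cg y) (cf _)).
have /integrableP[mf _] := continuous_integrable mu cG cf.
congr fine.
have := @integral_pushforward _ _ _ _ _ _ mg mu setT _ mf intfg measurableT.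
rewrite preimage_setT => <-.
by apply: eq_measure_integral => B mB _; exact: haar.
Qed.

Lemma cintegral_translate (g : G) (f : G -> R[i]) : ccontinuous f ->
  cintegral mu (fun y => f (g * y)%g) = cintegral mu f.
Proof.
move=> [fR fI]; apply: complex_eq => /=.
  exact: (Int_translate g fR).
exact: (Int_translate g fI).
Qed.

(** Multiplication [(u, y) |-> c^-1(u) y], with the left factor read in a chart,
is continuous. *)
Lemma open_mul_chart (c : chart R n G) (O : set G) : open O ->
  open [set p : 'rV[R]_n * G |
    chart_codom c p.1 /\ O (chart_inv c p.1 * p.2)%g].
Proof.
move=> oO; rewrite openE => -[u y] [/= Uu Oz].
have ci : {for (u, y), continuous (fun p : 'rV[R]_n * G => chart_inv c p.1)}.
  have c1 : {for (u, y), continuous (@fst 'rV[R]_n G)} by exact: cvg_fst.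
  exact: (continuous_comp c1 (chart_inv_continuous Uu)).
have cp : {for (u, y), continuous (fun p : 'rV[R]_n * G => (chart_inv c p.1, p.2))}.
  by apply: cvg_pair => //; exact: cvg_snd.
have cm : {for (u, y), continuous (fun p : 'rV[R]_n * G => (chart_inv c p.1 * p.2)%g)}.
  exact: (continuous_comp cp (@lie_mul_continuous _ _ _ _ lG _)).
have H1 : \forall p \near (u, y), O (chart_inv c p.1 * p.2)%g.
  by apply: cm; exact: open_nbhs_nbhs.
have H2 : \forall p \near (u, y), (chart_codom c `*` [set: G]) p.
  by apply: open_nbhs_nbhs; split => //; apply/open_setXT/chart_codom_open.
by apply: filterS2 H1 H2 => p Op [].
Qed.

Section Bump.
Variables (c0 : chart R n G) (s : R).
Hypotheses (ac0 : atlas c0).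

Definition chart_defect (z : G) : R :=
  s ^+ 2 - \sum_i (c0 z 0 i - c0 1%g 0 i) ^+ 2.

Definition bump (k : nat) (z : G) : R :=
  if z \in chart_dom c0 then pospow k (chart_defect z) else 0.

Definition bump_supp : set G := [set z | chart_dom c0 z /\ 0 <= chart_defect z].

Lemma bump_ge0 k z : 0 <= bump k z.
Proof. by rewrite /bump; case: ifP => // _; rewrite exprn_ge0// le_max lexx. Qed.

Lemma bump_outside k z : ~ bump_supp z -> bump k z = 0.
Proof.
rewrite /bump; case: ifPn => // /set_mem dz H.
rewrite /pospow max_l ?expr0n// leNgt; apply/negP => /ltW; move=> q0.
exact: H.
Qed.

(** Near a pair whose product lies in the chart domain, multiplication in charts
is smooth and the bump is a polynomial followed by [pospow]; near any other pair
the product avoids the closed support, and the function is 0. *)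
Lemma bump_Ck (c : chart R n G) k : closed bump_supp -> atlas c ->
  Ck (chart_codom c `*` [set: G]) k (fun u y => bump k (chart_inv c u * y)%g).
Proof.
move=> clS ac; apply: Ck_local => -[u0 y0] [/= Uu0 _].
have [dz|ndz] := pselect (chart_dom c0 (chart_inv c u0 * y0)%g); last first.
  exists [set p | chart_codom c p.1 /\ (~` bump_supp) (chart_inv c p.1 * p.2)%g].
    by split => // -[].
  apply: (Ck_eq (K := fun _ _ => 0)).
  - by apply: open_mul_chart; rewrite openC.
  - by move=> [u y] [/= _ Sz]; rewrite bump_outside.
  - by apply: Ck_cst => y; exact: cvg_cst.
have [c' ac' dy0] := (lie_atlas lG).1 y0.
pose Omega : set ('rV[R]_n * G) :=
  ([set p | chart_codom c p.1 /\ chart_dom c0 (chart_inv c p.1 * p.2)%g] `&`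
  [set p | chart_dom c' p.2]).
exists Omega; first by [].
have oO : open Omega.
  apply: openI; first exact/open_mul_chart/chart_dom_open.
  apply: open_comp (chart_dom_open c') => p _; exact: cvg_snd.
have mulO p : Omega p ->
    (chart_inv c p.1 * p.2 = chart_inv c (lsubmx (row_mx p.1 (c' p.2)))
     * chart_inv c' (rsubmx (row_mx p.1 (c' p.2))))%g.
  by move=> [_ dy]; rewrite row_mxKl row_mxKr chart_mapK.
have Cmul : Ck Omega k (fun u y => c0 (chart_inv c u * y)%g).
  apply: (Ck_eq oO _ (smooth_Ck (q := c') k oO (lie_mul_smooth lG ac ac' ac0) _)).
    by move=> p Op; rewrite (mulO p Op).
  move=> p Op; split; last first.
    by apply: chart_map_continuous; have [] := Op.
  have [[Up dz'] dy] := Op; split; rewrite ?row_mxKl ?row_mxKr//.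
    by exists p.2.
  by rewrite chart_mapK.
have Ccst (a : R) : Ck Omega k (fun _ _ => a).
  by apply: Ck_cst => y; exact: cvg_cst.
have Cdef : Ck Omega k (fun u y => chart_defect (chart_inv c u * y)%g).
  have Csq i : Ck Omega k (fun u y =>
      (c0 (chart_inv c u * y)%g 0 i - c0 1%g 0 i) ^+ 2).
    have C1 := CkD oO (Ck_coord i oO Cmul) (Ccst (- c0 1%g 0 i)).
    exact: (CkM oO C1 C1).
  have C2 := CkM oO (Ccst (-1)) (Ck_sum oO Csq).
  apply: Ck_eq oO _ (CkD oO (Ccst (s ^+ 2)) C2) => p _ /=.
  by rewrite mulN1r.
apply: Ck_eq oO _ (Ck_pospow oO Cdef) => p [[_ dz'] _].
by rewrite /bump mem_set.
Qed.

End Bump.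

(** The radius [s] must make the support closed in [G] and not only in the chart
domain.  By regularity of [G] choose a neighbourhood [B] of 1 whose closure lies
in [N] and in the chart domain; the support is contained in [B] for small [s],
so that its limit points stay in the domain, where the bump condition is
closed. *)
Lemma bump_exists (N : set G) : nbhs 1%g N ->
  exists phi : nat -> G -> R,
  [/\ forall k y, 0 <= phi k y, forall k, 0 < phi k 1%g,
      forall k y, ~ N y -> phi k y = 0 &
      forall k c, atlas c -> Ck (chart_codom c `*` [set: G]) k
        (fun u y => phi k (chart_inv c u * y)%g)].
Proof.
move=> nN; have [c0 ac0 d1] := (lie_atlas lG).1 1%g.
have nD : nbhs (1%g : G) (N `&` chart_dom c0).
  by apply: filterI => //; apply: open_nbhs_nbhs; split => //; exact: chart_dom_open.
have reg := compact_regular (lie_hausdorff lG) cG (filterT : nbhs (1%g : G) setT).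
have [B nB BN] := reg _ _ nD.
have co1 : chart_codom c0 (c0 1%g) by exists 1%g.
have : \forall w \near c0 1%g, B (chart_inv c0 w).
  by apply: (chart_inv_continuous co1); rewrite chart_mapK.
move=> /nbhs_ballP [r /= r0 Hr].
pose s := r / 2; have s0 : 0 < s by rewrite divr_gt0.
have SB z : bump_supp c0 s z -> B z.
  move=> [dz qz]; rewrite -(chart_mapK dz); apply: Hr; split => // i j.
  rewrite ord1 -ball_normE /= distrC.
  apply: (@le_lt_trans _ _ s); last by rewrite /s ltr_pdivrMr// ltr_pMr// ltr1n.
  rewrite -(@ler_pXn2r _ 2)// ?nnegrE ?(ltW s0)// real_normK ?num_real//.
  move: qz; rewrite /chart_defect subr_ge0 => qz; apply: le_trans qz.
  by rewrite (bigD1 j)//= lerDl sumr_ge0// => i' _; exact: sqr_ge0.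
have clS : closed (bump_supp c0 s).
  move=> z clz; have [Nz dz] : (N `&` chart_dom c0) z.
    by apply: BN => A nA; have [y [Sy Ay]] := clz _ nA; exists y; split => //; exact: SB.
  split => //; rewrite leNgt; apply/negP => qz.
  have cq : {for z, continuous (chart_defect c0 s)}.
    pose sq (w : 'rV[R]_n) : R := \sum_i (w 0 i - c0 1%g 0 i) ^+ 2.
    have csq : continuous sq.
      apply: continuous_sumr => i w.
      have ci : (fun v : 'rV[R]_n => v 0 i - c0 1%g 0 i) @ w --> w 0 i - c0 1%g 0 i.
        exact: cvgB (@coord_continuous _ _ _ 0 i w) (cvg_cst _).
      exact: (cvgM ci ci).
    apply: (@cvgB _ _ _ _ _ (fun=> s ^+ 2) (fun y => sq (c0 y))).
      exact: cvg_cst.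
    exact: (continuous_comp (chart_map_continuous dz) (csq _)).
  have nq : \forall y \near z, chart_defect c0 s y < 0.
    exact: (cq _ (lt_nbhsl qz)).
  by have [y [[_ qy] /= ny]] := clz _ nq; move: ny; rewrite ltNge qy.
exists (bump c0 s); split.
- by move=> k y; exact: bump_ge0.
- move=> k; rewrite /bump mem_set// exprn_gt0// lt_max /chart_defect.
  rewrite big1 ?subr0 ?exprn_gt0 ?orbT// => i _.
  by rewrite subrr expr0n.
- move=> k y Ny; apply: bump_outside => Sy; apply: Ny.
  have [] // : (N `&` chart_dom c0) y.
  by apply: BN; apply: subset_closure; exact: SB.
- by move=> k c; exact: bump_Ck.
Qed.

(** Finitely many translates of [phi] have a sum with a positive minimum, by
compactness; if the integral of [phi] vanished, so would that of the sum. *)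
Lemma Int_gt0 (phi : G -> R) : continuous phi -> (forall y, 0 <= phi y) ->
  0 < phi 1%g -> 0 < Int phi.
Proof.
move=> cphi phi0 phi1.
have ctr g : continuous (fun y => phi (g * y)%g).
  by move=> y; exact: (continuous_comp (lmul_continuous (g := g) (x := y)) (cphi _)).
have c0 : continuous (fun _ : G => 0 : R) by move=> x; exact: cvg_cst.
have ge0 : 0 <= Int phi.
  by have := le_Int mu cG c0 cphi phi0; rewrite Int_cst.
rewrite lt_neqAle ge0 andbT; apply/negP => /eqP I0.
have := cG; rewrite compact_cover => /(_ G setT (fun g => [set y | 0 < phi (g * y)%g])) [].
- move=> g _; apply: (@open_comp _ _ (fun y => phi (g * y)%g) [set t | 0 < t]).
    by move=> y _; exact: ctr.
  exact: open_gt.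
- by move=> y _; exists (y^-1)%g => //=; rewrite mulVg.
move=> D _ covD.
pose S y := \sum_(g <- finmap.enum_fset D) phi (g * y)%g.
have cS : continuous S by exact: continuous_sumr.
have Spos y : 0 < S y.
  have [g /= gD gy] := covD y I.
  rewrite /S (big_rem g) //= ltr_wpDr// sumr_ge0// => h _; exact: phi0.
have ne : [set: G] !=set0 by exists 1%g.
have wS : {within [set: G], continuous S} by exact: continuous_subspaceT.
have [y0 _ Hy] := compact_EVT_min ne cG wS.
have IS : Int S = 0.
  rewrite Int_sum//; apply: big1 => g _.
  by rewrite (Int_translate g cphi) -I0.
have cst0 : continuous (fun _ : G => S y0) by move=> x; exact: cvg_cst.
have := le_Int mu cG cst0 cS (fun y => Hy y (mem_set I)).
by rewrite Int_cst IS leNgt Spos.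
Qed.

Lemma Cinf_ccontinuous (f : G -> R[i]) : Cinf atlas f -> ccontinuous f.
Proof.
move=> sf.
have key (h : G -> R) : (forall c, atlas c ->
    smooth_on (chart_codom c) (fun u => h (chart_inv c u))) -> continuous h.
  move=> sh x; have [c ac dx] := (lie_atlas lG).1 x.
  have cx : chart_codom c (c x) by exists x.
  have ch := differentiable_continuous (sh c ac [::] _ cx).
  have cc : {for x, continuous (fun y => h (chart_inv c (c y)))}.
    exact: (continuous_comp (chart_map_continuous dx) ch).
  rewrite /continuous_at -[in nbhs (h x)](chart_mapK dx).
  apply: cvg_trans cc; apply: near_eq_cvg.
  have : \forall y \near x, chart_dom c y.
    by apply: open_nbhs_nbhs; split => //; exact: chart_dom_open.
  by apply: filterS => y dy; rewrite /= chart_mapK.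
by split; apply: key => c /sf[].
Qed.

Section Representation.
Variables (d : nat) (xi : G -> 'M[R[i]]_d).
Hypothesis rep : unitary_irrep xi.

Lemma rep_ccontinuous i j : ccontinuous (fun x => xi x i j).
Proof. by split=> x; have [] := irrep_continuous rep i j. Qed.

Lemma rep_inv x : xi (x^-1)%g = map_mx Num.conj (xi x)^T.
Proof.
rewrite -invmx_unitary; last exact: irrep_unitary rep x.
have xU := unitarymx_unit (irrep_unitary rep x).
apply: (can_inj (mulKmx xU)).
by rewrite mulmxV// -(irrep_mul rep) mulgV (irrep_one rep).
Qed.

Definition rep_avg (f : G -> R) : 'M[R[i]]_d :=
  \matrix_(i, j) cintegral mu (fun y => (f y)%:C * xi y i j).

Lemma real_ccontinuous (f : G -> R) : continuous f -> ccontinuous (fun y => (f y)%:C).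
Proof. by move=> cf; split=> // x; exact: cvg_cst. Qed.

(** Write [xi(y) = xi(x^-1) xi(x y)] and substitute [x y] by [y]. *)
Lemma rep_avg_translate (f : G -> R) (x : G) : continuous f ->
  rep_avg (fun y => f (x * y)%g) = xi (x^-1)%g *m rep_avg f.
Proof.
move=> cf; apply/matrixP => i j; rewrite !mxE.
have cfx k : ccontinuous (fun y => (f y)%:C * xi y k j).
  by apply: ccontinuousM (rep_ccontinuous k j); exact: real_ccontinuous.
have cz k : ccontinuous (fun y => xi (x^-1)%g i k * ((f y)%:C * xi y k j)).
  by apply: ccontinuousM (cfx k); exact: ccontinuous_cst.
under [RHS]eq_bigr => k _ do rewrite mxE -cintegralZ//.
rewrite -cintegral_sum//.
have cS := ccontinuous_sum (index_enum 'I_d) cz.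
rewrite -(cintegral_translate x cS).
apply: eq_cintegral => y.
have -> : xi y i j = \sum_k xi (x^-1)%g i k * xi (x * y)%g k j.
  by rewrite -[in LHS](mulKg x y) (irrep_mul rep (x^-1)%g) mxE.
rewrite mulr_sumr.
by apply: eq_bigr => k _; ring.
Qed.

(** The constant [(2 d + 1)^-1] is chosen so that the deviations, which amount to
[2 d] real entries per column, add up to less than the diagonal. *)
Lemma rep_avg_unitmx (f : G -> R) : continuous f -> (forall y, 0 <= f y) ->
  0 < f 1%g ->
  (forall y, f y != 0 -> forall i j,
    `|complex.Re (xi y i j) - (i == j)%:R| <= (2 * d%:R + 1)^-1 /\
    `|complex.Im (xi y i j)| <= (2 * d%:R + 1)^-1) ->
  rep_avg f \in unitmx.
Proof.
move=> cf f0 f1 Hf; set e := _^-1 in Hf.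
have If := Int_gt0 cf f0 f1.
have dp : 0 < 2 * d%:R + 1 :> R by rewrite ltr_wpDl// mulr_ge0.
have cfe : continuous (fun y => e * f y).
  by move=> y; apply: cvgM; [exact: cvg_cst|exact: cf].
have bnd (g : G -> R) : continuous g -> (forall y, f y != 0 -> `|g y| <= e) ->
    `|Int (fun y => f y * g y)| <= e * Int f.
  move=> cg Hg; rewrite -IntZ//; apply: Int_norm_le => //.
    by move=> y; apply: cvgM; [exact: cf|exact: cg].
  move=> y; have [->|fy] := eqVneq (f y) 0; first by rewrite mul0r mulr0 normr0.
  by rewrite normrM ger0_norm// mulrC ler_wpM2r// Hg.
apply: (@near_scalar_unitmx _ _ _ (Int f) (e * Int f)) => //.
- by rewrite mulrA gtr_pMl// /e ltr_pdivrMr// mul1r ltrDl.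
- move=> i j; rewrite mxE /=.
  have [cR cI] := rep_ccontinuous i j.
  pose dl : R := (i == j)%:R.
  have cg : continuous (fun y => complex.Re (xi y i j) - dl).
    by move=> y; apply: cvgB; [exact: cR|exact: cvg_cst].
  rewrite (_ : _ - _ = Int (fun y => f y * (complex.Re (xi y i j) - dl))).
    by apply: bnd => // y /Hf/(_ i j)[].
  have [cfR _] := ccontinuousM (real_ccontinuous cf) (rep_ccontinuous i j).
  have cdf : continuous (fun y => dl * f y).
    by move=> y; apply: cvgM; [exact: cvg_cst|exact: cf].
  rewrite -mulr_natl -IntZ// -IntB//; apply: eq_Rintegral => y _.
  by rewrite ReM /= mul0r subr0 mulrBr [dl * _]mulrC.
- move=> i j; rewrite mxE /=.
  have [cR cI] := rep_ccontinuous i j.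
  rewrite [X in `|X|](_ : _ = Int (fun y => f y * complex.Im (xi y i j))).
    by apply: bnd => // y /Hf/(_ i j)[].
  by apply: eq_Rintegral => y _; rewrite ImM /= mul0r addr0.
Qed.

(** For each [k], unitarity turns [xi(x^-1) = M(f(x .)) M(f)^-1] into a formula
for [xi(x)], in which the real and imaginary parts are linear combinations of
integrals of class [C^k] in the coordinates of [x]. *)
Lemma rep_Cinf i j : Cinf atlas (fun x => xi x i j).
Proof.
pose e : R := (2 * d%:R + 1)^-1.
have e0 : 0 < e by rewrite invr_gt0 ltr_wpDl// mulr_ge0.
pose N := [set y : G | forall ij : 'I_d * 'I_d,
  `|complex.Re (xi y ij.1 ij.2) - (ij.1 == ij.2)%:R| <= e /\
  `|complex.Im (xi y ij.1 ij.2)| <= e].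
have nN : nbhs 1%g N.
  apply: (@filter_forall _ _ (fun (ij : 'I_d * 'I_d) (y : G) =>
    `|complex.Re (xi y ij.1 ij.2) - (ij.1 == ij.2)%:R| <= e /\
    `|complex.Im (xi y ij.1 ij.2)| <= e) (nbhs (1%g : G)) _) => -[k l] /=.
  have [cR cI] := rep_ccontinuous k l.
  have /cvgrPdist_le /(_ _ e0) := cR 1%g.
  have /cvgrPdist_le /(_ _ e0) := cI 1%g.
  rewrite (irrep_one rep) mxE; apply: filterS2 => y /=.
  case: (k == l); rewrite ?mulr1n ?mulr0n /= sub0r normrN;
    by rewrite distrC => HI HR.
have [phi [phi0 phi1 phiN phiC]] := bump_exists nN.
have cphi k : continuous (phi k).
  have [c ac d1] := (lie_atlas lG).1 1%g => y.
  have c1 : chart_codom c (c 1%g) by exists 1%g.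
  have := continuous_section (Ck_continuous (phiC k c ac) (p := (c 1%g, y)) (conj c1 I)).
  suff -> : (fun z => phi k (chart_inv c (c 1%g) * z)%g) = phi k by [].
  by apply/funext => z; rewrite chart_mapK// mul1g.
have unitM k : rep_avg (phi k) \in unitmx.
  apply: rep_avg_unitmx => // y fy k' l.
  have [/(_ (k', l))//|/phiN] := pselect (N y).
  by move=> /(_ k) H; rewrite H eqxx in fy.
move=> c ac.
pose U := chart_codom c; have oU : open U by exact: chart_codom_open.
have oO : open (U `*` [set: G]) by exact: open_setXT.
have CT k (a : G -> R) : continuous a ->
    Ck (U `*` [set: G]) k (fun u _ => Int (fun y => phi k (chart_inv c u * y)%g * a y)).
  move=> ca; apply: (Ck_Int mu cG oU (K := fun u y => phi k (chart_inv c u * y)%g * a y)).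
  by apply: CkM => //; [exact: phiC|exact: Ck_cst].
have CRI k k' l :
    Ck (U `*` [set: G]) k (fun u _ =>
      complex.Re (rep_avg (fun y => phi k (chart_inv c u * y)%g) k' l)) /\
    Ck (U `*` [set: G]) k (fun u _ =>
      complex.Im (rep_avg (fun y => phi k (chart_inv c u * y)%g) k' l)).
  have [cR cI] := rep_ccontinuous k' l; split.
    apply: Ck_eq oO _ (CT k _ cR) => p _ /=; rewrite mxE /=.
    by apply: eq_Rintegral => y _; rewrite ReM /= mul0r subr0.
  apply: Ck_eq oO _ (CT k _ cI) => p _ /=; rewrite mxE /=.
  by apply: eq_Rintegral => y _; rewrite ImM /= mul0r addr0.
have xiE k u : xi (chart_inv c u) i j = Num.conj (\sum_l
    rep_avg (fun y => phi k (chart_inv c u * y)%g) j l * invmx (rep_avg (phi k)) l i).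
  have := rep_avg_translate (chart_inv c u) (cphi k).
  move=> /(congr1 (mulmx^~ (invmx (rep_avg (phi k))))).
  rewrite mulmxK// rep_inv => /matrixP/(_ j i); rewrite !mxE => ->.
  by rewrite conjCK.
have Ccst k (a : R) : Ck (U `*` [set: G]) k (fun _ _ => a).
  by apply: Ck_cst => y; exact: cvg_cst.
split; apply: (Ck_smooth (1%g : G)) => k.
  apply: (Ck_eq (K := fun u _ => \sum_l
   (complex.Re (rep_avg (fun y => phi k (chart_inv c u * y)%g) j l)
     * complex.Re (invmx (rep_avg (phi k)) l i)
   + (complex.Im (rep_avg (fun y => phi k (chart_inv c u * y)%g) j l)
     * (- complex.Im (invmx (rep_avg (phi k)) l i)))) ) oO).
    move=> p _; rewrite (xiE k) Re_conj Re_sum; apply: eq_bigr => l _.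
    by rewrite ReM mulrN.
  apply: (Ck_sum (K := fun l u _ => _)) => // l; have [CR CI] := CRI k j l.
  by apply: CkD => //; apply: CkM.
apply: (Ck_eq (K := fun u _ => \sum_l
   (complex.Re (rep_avg (fun y => phi k (chart_inv c u * y)%g) j l)
     * (- complex.Im (invmx (rep_avg (phi k)) l i))
   + (complex.Im (rep_avg (fun y => phi k (chart_inv c u * y)%g) j l)
     * (- complex.Re (invmx (rep_avg (phi k)) l i)))) ) oO).
  move=> p _; rewrite (xiE k) Im_conj Im_sum -sumrN; apply: eq_bigr => l _.
  by rewrite ImM !mulrN opprD.
apply: (Ck_sum (K := fun l u _ => _)) => // l; have [CR CI] := CRI k j l.
by apply: CkD => //; apply: CkM.
Qed.

End Representation.
End LieGroup.

Theorem lemma3p2 (R : realType) (n : nat) (G : preTopologicalGroupType)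
    (atlas : set (chart R n G)) (mu : probability (borelType G) R)
    (A : (G -> R[i]) -> (G -> R[i])) (d : nat) (xi : G -> 'M[R[i]]_d) :
  lie_group atlas ->
  compact [set: G] ->
  normalised_haar mu ->
  pseudo_differential atlas 0 A ->
  unitary_irrep xi ->
  \sum_(i < d) \sum_(j < d)
    inner mu (A (fun x => xi x i j)) (fun x => xi x i j) =
  cintegral mu (fun x => \tr (global_symbol A x xi)).
Proof.
move=> lG cG haar psiA rep.
have cA i j : ccontinuous (A (fun x => xi x i j)).
  by apply: (Cinf_ccontinuous lG); apply: (pdo_Cinf psiA); exact: (rep_Cinf lG cG haar rep).
have cterm i j : ccontinuous (fun x => A (fun x => xi x i j) x * Num.conj (xi x i j)).
  by apply: ccontinuousM => //; apply: ccontinuous_conj; exact: rep_ccontinuous rep i j.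
under eq_bigr => i _ do rewrite /inner -cintegral_sum//.
rewrite -cintegral_sum//; last by move=> i; exact: ccontinuous_sum.
apply: eq_cintegral => x; rewrite /mxtrace /global_symbol.
under [RHS]eq_bigr => i _ do rewrite mxE.
rewrite exchange_big; apply: eq_bigr => j _; apply: eq_bigr => i _.
by rewrite !mxE mulrC.
Qed.
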